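(* Let $S$ be a countable distributive $0$-semilattice. Then $S$ is isomorphic to the maximal semilattice quotient $\nabla(E^+)$ of the positive cone $E^+$ of some countable dimension vector space $E$. If, in addition, $S$ is bounded, then $E$ has an order-unit.
   Context: A semilattice is a commutative semigroup $(S,\vee)$ with all elements idempotent, ordered by $x\le y\iff x\vee y=y$; a $0$-semilattice is a semilattice with a least element $0$. It is bounded if it has both a least and a greatest element. It is distributive if for all $a,b_0,b_1$ with $a\le b_0\vee b_1$ there are $a_0\le b_0$ and $a_1\le b_1$ with $a=a_0\vee a_1$. For a commutative monoid $M$ (written additively), the algebraic preordering is $x\le y\iff \exists z\in M,\ x+z=y$. Put $x\propto y$ iff $x\le ny$ for some positive integer $n$, and $x\asymp y$ iff $x\propto y$ and $y\propto x$. Then $\asymp$ is the least monoid congruence on $M$ whose quotient is a semilattice; the maximal semilattice quotient of $M$ is $\nabla(M)=M/{\asymp}$. For a partially ordered abelian group $G$, $G^+=\{x\in G: x\ge 0\}$ is its positive cone. An order-unit of $G$ is an element $u\in G^+$ such that for every $x\in G$ there is a positive integer $n$ with $x\le nu$. $G$ is an interpolation group if whenever $a_0,a_1,b_0,b_1\in G$ satisfy $a_i\le b_j$ for all $i,j<2$, there is $x\in G$ with $a_i\le x\le b_j$ for all $i,j<2$. $G$ is directed if $G=G^++(-G^+)$. A dimension vector space is a directed interpolation group endowed with a structure of vector space over $\mathbb{Q}$ for which multiplication by positive rational scalars is order-preserving. *)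

(* Defs.v *)
From HB Require Import structures.
From mathcomp Require Import all_boot all_order all_algebra.
From mathcomp Require Import boolp classical_sets functions cardinality.

Set Implicit Arguments.
Unset Strict Implicit.
Unset Printing Implicit Defensive.

Import Order.TTheory GRing.Theory.

Local Open Scope ring_scope.
Local Open Scope quotient_scope.

(** * Semilattices *)

Section Semilattices.
Local Open Scope order_scope.

Definition distributive_semilattice d (S : joinSemilatticeType d) : Prop :=
  forall a b0 b1 : S, a <= b0 `|` b1 ->
  exists a0 a1 : S, [/\ a0 <= b0, a1 <= b1 & a = a0 `|` a1].

(* A [bJoinSemilatticeType] already has a least element. *)
Definition bounded_semilattice d (S : bJoinSemilatticeType d) : Prop :=
  exists t : S, forall x : S, x <= t.

(* A bijective join-morphism preserves and reflects the order, hence also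
   preserves the least element. *)
Definition semilattice_isomorphic d d' (S : joinSemilatticeType d)
    (T : joinSemilatticeType d') : Prop :=
  exists f : S -> T, bijective f /\ {morph f : x y / x `|` y}.

End Semilattices.

(** * The maximal semilattice quotient of a commutative monoid *)

Section Asymp.
Variable M : nmodType.
Implicit Types x y z : M.

Definition alg_le x y : Prop := exists z, x + z = y.
Definition propto x y : Prop := exists2 n : nat, (0 < n)%N & alg_le x (y *+ n).
Definition asymp x y : Prop := propto x y /\ propto y x.

Lemma propto_refl x : propto x x.
Proof. by exists 1%N => //; exists 0; rewrite addr0 mulr1n. Qed.

Lemma propto_trans x y z : propto x y -> propto y z -> propto x z.
Proof.
move=> [n n0 [u xu]] [m m0 [v yv]]; exists (m * n)%N; first by rewrite muln_gt0 m0.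
by exists (u + v *+ n); rewrite addrA xu -mulrnDl yv mulrnA.
Qed.

Lemma propto_addr x y : propto x (x + y).
Proof. by exists 1%N => //; exists y; rewrite mulr1n. Qed.

Lemma propto_addl x y : propto y (x + y).
Proof. by rewrite addrC; apply: propto_addr. Qed.

Lemma propto_lub x y z : propto x z -> propto y z -> propto (x + y) z.
Proof.
move=> [n n0 [u xu]] [m m0 [v yv]]; exists (n + m)%N; first by rewrite addn_gt0 n0.
by exists (u + v); rewrite addrACA xu yv mulrnDr.
Qed.

Lemma proptoD x x' y y' : propto x x' -> propto y y' -> propto (x + y) (x' + y').
Proof.
move=> xx' yy'; apply: propto_lub.
  exact: propto_trans xx' (propto_addr _ _).
exact: propto_trans yy' (propto_addl _ _).
Qed.

Definition asympb x y : bool := `[< asymp x y >].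

Lemma asympb_refl : reflexive asympb.
Proof. by move=> x; apply/asboolP; split; apply: propto_refl. Qed.

Lemma asympb_sym : symmetric asympb.
Proof. by move=> x y; apply/asboolP/asboolP => -[]. Qed.

Lemma asympb_trans : transitive asympb.
Proof.
move=> y x z /asboolP[xy yx] /asboolP[yz zy]; apply/asboolP; split.
  exact: propto_trans xy yz.
exact: propto_trans zy yx.
Qed.

Canonical asymp_equiv := EquivRel asympb asympb_refl asympb_sym asympb_trans.

Definition nabla := {eq_quot asymp_equiv}.

HB.instance Definition _ := Choice.on nabla.
HB.instance Definition _ := EqQuotient.on nabla.

Definition nabla_join (a b : nabla) : nabla := \pi_nabla (repr a + repr b).

Lemma pi_nablaP x y : \pi_nabla x = \pi_nabla y <-> asymp x y.
Proof. by split=> [/eqmodP/asboolP|xy] //; apply/eqmodP/asboolP. Qed.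

Lemma pi_nabla_join x y :
  nabla_join (\pi_nabla x) (\pi_nabla y) = \pi_nabla (x + y).
Proof.
rewrite /nabla_join; apply/pi_nablaP.
have [xx' x'x] : asymp (repr (\pi_nabla x)) x by apply/pi_nablaP; rewrite reprK.
have [yy' y'y] : asymp (repr (\pi_nabla y)) y by apply/pi_nablaP; rewrite reprK.
by split; apply: proptoD.
Qed.

Definition nabla_le (a b : nabla) : bool := nabla_join a b == b.

Lemma pi_nabla_le x y : nabla_le (\pi_nabla x) (\pi_nabla y) <-> propto x y.
Proof.
rewrite /nabla_le pi_nabla_join; split=> [/eqP/pi_nablaP[xyy _]|xy].
  exact: propto_trans (propto_addr _ _) xyy.
apply/eqP/pi_nablaP; split; last exact: propto_addl.
by apply: propto_lub xy _; apply: propto_refl.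
Qed.

Lemma nabla_le_refl : reflexive nabla_le.
Proof. by elim/quotW=> x; apply/pi_nabla_le/propto_refl. Qed.

Lemma nabla_le_anti : antisymmetric nabla_le.
Proof.
elim/quotW=> x; elim/quotW=> y /andP[/pi_nabla_le xy /pi_nabla_le yx].
exact/pi_nablaP.
Qed.

Lemma nabla_le_trans : transitive nabla_le.
Proof.
elim/quotW=> y; elim/quotW=> x; elim/quotW=> z /pi_nabla_le xy /pi_nabla_le yz.
exact/pi_nabla_le/(propto_trans xy yz).
Qed.

Fact nabla_display : Order.disp_t. Proof. exact: Order.Disp tt tt. Qed.

HB.instance Definition _ := Order.Le_isPOrder.Build nabla_display nabla
  nabla_le_refl nabla_le_anti nabla_le_trans.

Lemma nabla_leUx (a b c : nabla) :
  (nabla_join a b <= c)%O = (a <= c)%O && (b <= c)%O.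
Proof.
elim/quotW: a => x; elim/quotW: b => y; elim/quotW: c => z.
rewrite pi_nabla_join; apply/idP/andP => [/pi_nabla_le xyz|[]].
  split; apply/pi_nabla_le.
    exact: propto_trans (propto_addr _ _) xyz.
  exact: propto_trans (propto_addl _ _) xyz.
by move=> /pi_nabla_le xz /pi_nabla_le yz; apply/pi_nabla_le/propto_lub.
Qed.

HB.instance Definition _ :=
  Order.POrder_isJoinSemilattice.Build nabla_display nabla nabla_leUx.

Lemma nabla_le0x (a : nabla) : (\pi_nabla 0 <= a)%O.
Proof.
elim/quotW: a => x; apply/pi_nabla_le.
by exists 1%N => //; exists x; rewrite add0r mulr1n.
Qed.

HB.instance Definition _ :=
  Order.hasBottom.Build nabla_display nabla nabla_le0x.

End Asymp.

(** * Partially ordered abelian groups *)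

(* [Num.POrderedZmodule] only joins an order and a group structure; the
   translation invariance of the order has to be required. *)
HB.mixin Record isPOGroup G of Num.POrderedZmodule G := {
  pog_leD2r : forall z x y : G, x <= y -> x + z <= y + z
}.

#[short(type="poGroupType")]
HB.structure Definition POGroup := { G of Num.POrderedZmodule G & isPOGroup G }.

Definition directed_group (G : poGroupType) : Prop :=
  forall x : G, exists a b : G, [/\ 0 <= a, 0 <= b & x = a - b].

Definition interpolation_group (G : poGroupType) : Prop :=
  forall a0 a1 b0 b1 : G,
    a0 <= b0 -> a0 <= b1 -> a1 <= b0 -> a1 <= b1 ->
  exists x : G, [/\ a0 <= x, a1 <= x, x <= b0 & x <= b1].

Definition order_unit (G : poGroupType) (u : G) : Prop :=
  0 <= u /\ forall x : G, exists2 n : nat, (0 < n)%N & x <= u *+ n.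

Section PosCone.
Variable G : poGroupType.

Lemma pos_cone_nmod_closed : GRing.nmod_closed (fun x : G => 0 <= x).
Proof.
split=> [|x y]; rewrite !unfold_in // => x0 y0.
by apply: le_trans y0 _; rewrite -[leLHS]add0r; apply: pog_leD2r.
Qed.

Record pos_cone := PosCone {
  pos_cone_val :> G;
  pos_coneP : 0 <= pos_cone_val
}.

HB.instance Definition _ := [isSub for pos_cone_val].
HB.instance Definition _ := [Choice of pos_cone by <:].
HB.instance Definition _ := GRing.SubChoice_isSubNmodule.Build
  G (fun x : G => 0 <= x) pos_cone pos_cone_nmod_closed.

End PosCone.

(** * Dimension vector spaces *)

HB.mixin Record isDimVect E of POGroup E & GRing.Lmodule rat E := {
  dimv_directed : directed_group E;
  dimv_interpolation : interpolation_group E;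
  dimv_scale : forall (q : rat) (x y : E), 0 < q -> x <= y -> q *: x <= q *: y
}.

#[short(type="dimVectType")]
HB.structure Definition DimVect :=
  { E of POGroup E & GRing.Lmodule rat E & isDimVect E }.

(* Main.v *)
Require Import Defs.
From HB Require Import structures.
From mathcomp Require Import all_boot all_order all_algebra ring_quotient.
From mathcomp Require Import boolp classical_sets functions cardinality.

(* Label the basis of W = Q^(nat) by a surjection l : nat -> S. Replacing each
   basis vector e_i by a finite sum of vectors e_k whose labels join to l i is a
   positive endomorphism of W that preserves the join of the labels of the support
   of a positive vector. By distributivity, if the labels of v >= 0 lie below the
   join of those of w >= 0, then one such replacement takes the support of v into
   that of w, so that v becomes bounded by a multiple of w. Scheduling these
   replacements for all pairs of vectors gives a sequence W -> W -> ... whose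
   direct limit E is a dimension vector space in which x is dominated by a multiple
   of y exactly when the label of x is below the label of y. Hence the label
   induces an isomorphism from the maximal semilattice quotient of E^+ onto S. *)

Set Implicit Arguments.
Unset Strict Implicit.
Unset Printing Implicit Defensive.

Import Order.TTheory GRing.Theory Num.Theory.

Local Open Scope ring_scope.
Local Open Scope quotient_scope.

(** * Finitely supported rational vectors, encoded as polynomials, and coordinatewise positivity *)

Section Nneg.
Implicit Types v w : {poly rat}.

Definition nneg w := forall i, 0 <= w`_i.

Lemma nneg0 : nneg 0.
Proof. by move=> i; rewrite coef0. Qed.

Lemma nnegD v w : nneg v -> nneg w -> nneg (v + w).
Proof. by move=> v0 w0 i; rewrite coefD addr_ge0. Qed.

Lemma nnegZ (c : rat) w : 0 <= c -> nneg w -> nneg (c *: w).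
Proof. by move=> c0 w0 i; rewrite coefZ mulr_ge0. Qed.

Definition pos_part w : {poly rat} := \poly_(i < size w) Num.max w`_i 0.

Lemma coef_pos_part w i : (pos_part w)`_i = Num.max w`_i 0.
Proof. by rewrite coef_poly; case: ltnP => // iw; rewrite nth_default ?maxxx. Qed.

(** Each coordinate below [size v] needs only a finite multiple of [w]; the sum of these multiples
    serves all coordinates at once. *)
Lemma nneg_dominated v w : nneg v -> nneg w -> (forall i, v`_i != 0 -> w`_i != 0) ->
  exists n, nneg (w *+ n - v).
Proof.
move=> v0 w0 vw; exists (\sum_(i < size v) (Num.truncn (v`_i / w`_i)%R).+1)%N => k.
rewrite coefB coefMn subr_ge0.
have [vk|vk] := boolP (v`_k == 0); first by rewrite (eqP vk) mulrn_wge0.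
have kv : (k < size v)%N by rewrite ltnNge; apply: contra vk => /(nth_default 0)->.
have wk : 0 < w`_k by rewrite lt0r vw //= w0.
rewrite -mulr_natr mulrC -ler_pdivrMr //.
apply: (@le_trans _ _ ((Num.truncn (v`_k / w`_k)).+1)%:R).
  by rewrite ltW // truncnS_gt.
by rewrite ler_nat (bigD1 (Ordinal kv)) //= leq_addr.
Qed.

End Nneg.

(** * Positive endomorphisms replacing basis vectors by finite sums *)

Section Transfer.
Variable g : nat -> seq nat.
Implicit Types v w : {poly rat}.

Definition transfer w : {poly rat} :=
  \sum_(i < size w) w`_i *: \sum_(k <- g i) 'X^k.

Lemma transfer_widen n w : (size w <= n)%N ->
  transfer w = \sum_(i < n) w`_i *: \sum_(k <- g i) 'X^k.
Proof.
move=> wn; rewrite /transfer (big_ord_widen n (fun i => w`_i *: \sum_(k <- g i) 'X^k)) //.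
rewrite big_mkcond /=; apply: eq_bigr => i _; case: ltnP => // iw.
by rewrite nth_default ?scale0r.
Qed.

Lemma transfer_is_linear : linear transfer.
Proof.
move=> c v w; pose n := maxn (size v) (size w).
have vn : (size v <= n)%N by rewrite leq_maxl.
have wn : (size w <= n)%N by rewrite leq_maxr.
rewrite (transfer_widen vn) (transfer_widen wn) (@transfer_widen n); last first.
  rewrite (leq_trans (size_polyD _ _)) // geq_max wn andbT.
  exact: leq_trans (size_scale_leq _ _) vn.
rewrite scaler_sumr -big_split /=; apply: eq_bigr => i _.
by rewrite coefD coefZ scalerDl scalerA.
Qed.

HB.instance Definition _ :=
  GRing.isLinear.Build rat {poly rat} {poly rat} _ transfer transfer_is_linear.

Lemma coef_transfer w k :
  (transfer w)`_k = \sum_(i < size w) w`_i * (count_mem k (g i))%:R.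
Proof.
rewrite coef_sum; apply: eq_bigr => i _; rewrite coefZ coef_sum; congr (_ * _).
by elim: (g i) => [|j s IH]; rewrite ?big_nil ?big_cons //= IH coefXn natrD eq_sym.
Qed.

Lemma transfer_nneg w : nneg w -> nneg (transfer w).
Proof.
by move=> w0 k; rewrite coef_transfer sumr_ge0 // => i _; rewrite mulr_ge0 ?ler0n.
Qed.

(** All summands of a coordinate are nonnegative, so nothing cancels. *)
Lemma transfer_suppP w k : nneg w ->
  (transfer w)`_k != 0 <-> exists2 i, w`_i != 0 & k \in g i.
Proof.
move=> w0; rewrite coef_transfer psumr_neq0; last first.
  by move=> i _; rewrite mulr_ge0 ?ler0n.
split=> [/hasP[i _ /=]|[i wi gik]].
  rewrite lt0r mulf_eq0 negb_or pnatr_eq0 -lt0n -has_count has_pred1.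
  by case/andP=> /andP[wi gik] _; exists i.
have iw : (i < size w)%N by rewrite ltnNge; apply: contra wi => /(nth_default 0)->.
apply/hasP; exists (Ordinal iw); rewrite ?mem_index_enum //=.
by rewrite lt0r mulf_eq0 negb_or wi pnatr_eq0 -lt0n -has_count has_pred1 gik mulr_ge0.
Qed.

End Transfer.

(** * The direct limit as an ordered rational vector space *)

Section Limit.
Variable f : nat -> nat -> seq nat.
Implicit Types x y z : {poly {poly rat}}.

(* [x`_k] is a vector added at stage [k]: every [x] stands for the sum of the images of
   its coefficients in the direct limit, and [stage n x] ignores the [x`_k] with [k > n]. *)
Fixpoint stage n x : {poly rat} :=
  if n is m.+1 then transfer (f m) (stage m x) + x`_n else x`_0.

Lemma stage_is_zmod_morphism n : zmod_morphism (stage n).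
Proof.
move=> x y; elim: n => [|n IH] /=; first exact: coefB.
by rewrite IH raddfB coefB /= addrACA opprD.
Qed.

HB.instance Definition _ n :=
  GRing.isZmodMorphism.Build _ _ (stage n) (stage_is_zmod_morphism n).

Lemma stageZ n (c : rat) x : stage n (c%:P *: x) = c *: stage n x.
Proof.
elim: n => [|n IH] /=; first by rewrite coefZ mul_polyC.
by rewrite IH linearZ coefZ mul_polyC scalerDr.
Qed.

Lemma stageS n x : (size x <= n.+1)%N -> stage n.+1 x = transfer (f n) (stage n x).
Proof. by move=> xn /=; rewrite nth_default ?addr0. Qed.

Definition token n (w : {poly rat}) : {poly {poly rat}} := w *: 'X^n.

Lemma size_token n w : (size (token n w) <= n.+1)%N.
Proof. by rewrite (leq_trans (size_scale_leq _ _)) // size_polyXn. Qed.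

Lemma stage_token n w : stage n (token n w) = w.
Proof.
have low m : (m < n)%N -> stage m (token n w) = 0.
  elim: m => [|m IH] mn /=; rewrite coefZ coefXn ltn_eqF ?mulr0 //.
  by rewrite IH 1?ltnW // raddf0 addr0.
case: n low => [|n] low /=; first by rewrite coefZ coefXn eqxx mulr1.
by rewrite low // raddf0 add0r coefZ coefXn eqxx mulr1.
Qed.

(** Positivity in the limit. Once [n] reaches the size of [x], nothing more is added and positive
    maps take over, so one nonnegative stage then suffices. *)
Definition cone x := exists N, forall n, (N <= n)%N -> nneg (stage n x).

Lemma cone0 : cone 0.
Proof. by exists 0%N => n _; rewrite raddf0; exact: nneg0. Qed.

Lemma coneD x y : cone x -> cone y -> cone (x + y).
Proof.
move=> [N xN] [M yM]; exists (maxn N M) => n; rewrite geq_max => /andP[Nn Mn].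
by rewrite raddfD; apply: nnegD; [apply: xN|apply: yM].
Qed.

Lemma coneZ (c : rat) x : 0 <= c -> cone x -> cone (c%:P *: x).
Proof.
by move=> c0 [N xN]; exists N => n Nn; rewrite stageZ; apply: nnegZ => //; apply: xN.
Qed.

Lemma stage_nneg n m x : (size x <= n.+1)%N -> nneg (stage n x) ->
  (n <= m)%N -> nneg (stage m x).
Proof.
move=> xn x0; elim: m => [|m IH]; first by rewrite leqn0 => /eqP<-.
rewrite leq_eqVlt => /predU1P[<-//|nm]; rewrite stageS; last exact: leq_trans nm.
exact/transfer_nneg/IH.
Qed.

Lemma cone_stage n x : (size x <= n.+1)%N -> nneg (stage n x) -> cone x.
Proof. by move=> xn x0; exists n => m; apply: stage_nneg. Qed.

Lemma cone_stageB n x y : (size x <= n.+1)%N -> (size y <= n.+1)%N ->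
  (forall i, (stage n x)`_i <= (stage n y)`_i) -> cone (y - x).
Proof.
move=> xn yn xy; apply: (@cone_stage n).
  by rewrite (leq_trans (size_polyD _ _)) // geq_max size_polyN yn.
by move=> i; rewrite raddfB coefB subr_ge0.
Qed.

(** Both conditions together force [stage n x] to vanish for all large [n], so the quotient by
    [null] is the direct limit. *)
Definition null : {pred {poly {poly rat}}} :=
  fun x => `[< cone x /\ cone (- x) >].

Lemma nullP x : reflect (cone x /\ cone (- x)) (x \in null).
Proof. exact: asboolP. Qed.

Lemma null_zmod_closed : zmod_closed null.
Proof.
split=> [|x y /nullP[x0 x1] /nullP[y0 y1]]; apply/nullP.
  by rewrite oppr0; split; exact: cone0.
by rewrite opprB addrC; split; apply: coneD.
Qed.

HB.instance Definition _ := GRing.isZmodClosed.Build _ null null_zmod_closed.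

Definition limit := Quotient.quot null.

HB.instance Definition _ := GRing.Zmodule.on limit.
HB.instance Definition _ := EqQuotient.on limit.

Local Notation cls := (\pi_limit).

Lemma pi_limitP x y : cls x = cls y <-> cone (y - x) /\ cone (x - y).
Proof.
split=> [/eqP|[yx xy]].
  by rewrite -Quotient.idealrBE => /nullP; rewrite opprB => -[].
by apply/eqP; rewrite -Quotient.idealrBE; apply/nullP; rewrite opprB.
Qed.

Lemma limitD x y : cls (x + y) = cls x + cls y.
Proof. by rewrite !piE. Qed.

Lemma limitB x y : cls (x - y) = cls x - cls y.
Proof. by rewrite !piE. Qed.

Lemma limitMn x n : cls (x *+ n) = cls x *+ n.
Proof. by elim: n => [|n IH]; rewrite ?mulr0n ?piE // !mulrS limitD IH. Qed.

Definition limit_scale (c : rat) (a : limit) : limit := cls (c%:P *: repr a).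

Lemma limit_scaleE c x : limit_scale c (cls x) = cls (c%:P *: x).
Proof.
have [rx xr] : cone (x - repr (cls x)) /\ cone (repr (cls x) - x).
  by apply/pi_limitP; rewrite reprK.
apply/pi_limitP; rewrite -!scalerBr.
have [c0|/ltW c0] := leP 0 c; first by split; apply: coneZ.
(* For negative [c], scaling by [-c] exchanges the two differences. *)
rewrite -[c]opprK polyCN !scaleNr -!scalerN !opprB.
by split; apply: coneZ; rewrite ?oppr_ge0.
Qed.

Lemma limit_scaleA c e (a : limit) :
  limit_scale c (limit_scale e a) = limit_scale (c * e) a.
Proof. by elim/quotW: a => x; rewrite (limit_scaleE e) !limit_scaleE scalerA polyCM. Qed.

Lemma limit_scale1 : left_id 1 limit_scale.
Proof. by elim/quotW=> x; rewrite limit_scaleE scale1r. Qed.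

Lemma limit_scaleDr : right_distributive limit_scale +%R.
Proof.
move=> c; elim/quotW=> x; elim/quotW=> y.
by rewrite -limitD !limit_scaleE scalerDr limitD.
Qed.

Lemma limit_scaleDl (a : limit) : {morph limit_scale^~ a : c e / c + e}.
Proof.
by move=> c e; elim/quotW: a => x; rewrite !limit_scaleE -limitD -scalerDl polyCD.
Qed.

HB.instance Definition _ := GRing.Zmodule_isLmodule.Build rat limit
  limit_scaleA limit_scale1 limit_scaleDr limit_scaleDl.

Definition limit_le (a b : limit) := `[< cone (repr b - repr a) >].

Lemma limit_leE x y : limit_le (cls x) (cls y) <-> cone (y - x).
Proof.
have [rx xr] : cone (x - repr (cls x)) /\ cone (repr (cls x) - x).
  by apply/pi_limitP; rewrite reprK.
have [ry yr] : cone (y - repr (cls y)) /\ cone (repr (cls y) - y).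
  by apply/pi_limitP; rewrite reprK.
split=> [/asboolP le|le]; last apply/asboolP.
  have -> : y - x = (y - repr (cls y)) + (repr (cls y) - repr (cls x)) +
                    (repr (cls x) - x) by rewrite !subrKA.
  by apply: coneD => //; apply: coneD.
have -> : repr (cls y) - repr (cls x) = (repr (cls y) - y) + (y - x) +
                                        (x - repr (cls x)) by rewrite !subrKA.
by apply: coneD => //; apply: coneD.
Qed.

Lemma limit_le_refl : reflexive limit_le.
Proof. by elim/quotW=> x; apply/limit_leE; rewrite subrr; exact: cone0. Qed.

Lemma limit_le_anti : antisymmetric limit_le.
Proof.
by elim/quotW=> x; elim/quotW=> y /andP[/limit_leE xy /limit_leE yx]; apply/pi_limitP.
Qed.

Lemma limit_le_trans : transitive limit_le.
Proof.
elim/quotW=> y; elim/quotW=> x; elim/quotW=> z /limit_leE xy /limit_leE yz.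
by apply/limit_leE; rewrite -(subrKA y); apply: coneD.
Qed.

HB.instance Definition _ := Order.Le_isPOrder.Build ring_display limit
  limit_le_refl limit_le_anti limit_le_trans.

Lemma pi_limit_le x y : cls x <= cls y <-> cone (y - x).
Proof. exact: limit_leE. Qed.

Lemma pi_limit_ge0 x : 0 <= cls x <-> cone x.
Proof. by rewrite -[x in cone x]subr0 -pi_limit_le !piE. Qed.

Lemma limit_leD2r (c a b : limit) : a <= b -> a + c <= b + c.
Proof.
elim/quotW: a => x; elim/quotW: b => y; elim/quotW: c => z /pi_limit_le xy.
by rewrite -!limitD; apply/pi_limit_le; rewrite opprD addrACA subrr addr0.
Qed.

HB.instance Definition _ := isPOGroup.Build limit limit_leD2r.

(** * Directedness and interpolation *)

Lemma limit_directed : directed_group limit.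
Proof.
elim/quotW=> x; pose n := size x; pose p := token n (pos_part (stage n x)).
exists (cls p), (cls (p - x)).
rewrite -limitB subKr; split=> //; apply/pi_limit_ge0.
  apply: (@cone_stage n); first exact: size_token.
  by rewrite stage_token => i; rewrite coef_pos_part le_max lexx orbT.
apply: (@cone_stageB n); rewrite ?size_token ?leqnSn // => i.
by rewrite stage_token coef_pos_part le_max lexx.
Qed.

(** The vectors of one stage form a lattice, so at a late stage the coordinatewise maximum of the
    two lower elements interpolates. *)
Lemma limit_interpolation : interpolation_group limit.
Proof.
elim/quotW=> x0; elim/quotW=> x1; elim/quotW=> y0; elim/quotW=> y1.
move=> /pi_limit_le[N00 h00] /pi_limit_le[N01 h01].
move=> /pi_limit_le[N10 h10] /pi_limit_le[N11 h11].
(* Past the four thresholds the inequalities hold coordinatewise; past the four sizes no vector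
   remains to be added. *)
pose n := \max_(k <- [:: N00; N01; N10; N11; size x0; size x1; size y0; size y1]) k.
have le_n k : k \in [:: N00; N01; N10; N11; size x0; size x1; size y0; size y1] ->
    (k <= n)%N by move=> kn; exact: leq_bigmax_seq.
(* The maximum of [a] and [b] is [b] plus the positive part of [a - b]. *)
pose z := token n (stage n x1 + pos_part (stage n x0 - stage n x1)).
have zn : (size z <= n.+1)%N by exact: size_token.
have zE i : (stage n z)`_i = Num.max (stage n x0)`_i (stage n x1)`_i.
  by rewrite stage_token coefD coef_pos_part coefB addr_maxr addr0 subrKC.
have le_stage x y i : nneg (stage n (y - x)) -> (stage n x)`_i <= (stage n y)`_i.
  by move=> /(_ i); rewrite raddfB coefB subr_ge0.
exists (cls z); split; apply/pi_limit_le; apply: (@cone_stageB n) => // [|i];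
  try by rewrite leqW // le_n // !inE eqxx ?orbT.
- by rewrite zE le_max lexx.
- by rewrite zE le_max lexx orbT.
- rewrite zE ge_max !le_stage //; [apply: h10|apply: h00];
    by rewrite le_n // !inE eqxx ?orbT.
- rewrite zE ge_max !le_stage //; [apply: h11|apply: h01];
    by rewrite le_n // !inE eqxx ?orbT.
Qed.

Lemma limit_scale_mono (c : rat) (a b : limit) : 0 < c -> a <= b -> c *: a <= c *: b.
Proof.
elim/quotW: a => x; elim/quotW: b => y c0 /pi_limit_le xy.
rewrite /GRing.scale /= !limit_scaleE; apply/pi_limit_le.
by rewrite -scalerBr; apply: coneZ xy; exact: ltW.
Qed.

HB.instance Definition _ :=
  isDimVect.Build limit limit_directed limit_interpolation limit_scale_mono.

Lemma limit_countable : countable [set: limit].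
Proof.
apply/countable_injP; exists (pickle \o (repr : limit -> _)) => a b _ _.
by move=> /(pcan_inj pickleK) /(can_inj reprK).
Qed.

End Limit.

(** * Labels of supports and label-preserving replacements *)

Section Labels.
Variables (d : Order.disp_t) (S : bJoinSemilatticeType d) (l : nat -> S).
Implicit Types (v w : {poly rat}) (s t u : S) (g : nat -> seq nat).

(* [s] is the join of the labels on the support of [w]. *)
Definition labels w s := forall u, (s <= u)%O <-> forall i, w`_i != 0 -> (l i <= u)%O.

(** Says through upper bounds that the labels on [g i] join to [l i]. *)
Definition refines g := forall i u, (l i <= u)%O <-> forall k, k \in g i -> (l k <= u)%O.

(** The label comparison is a premise, so that every pair admits some [g] and all pairs can be
    scheduled. The inclusion of supports is what [nneg_dominated] requires. *)
Definition absorbs g v w :=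
  forall s t, nneg v -> nneg w -> labels v s -> labels w t -> (s <= t)%O ->
  forall k, (transfer g v)`_k != 0 -> (transfer g w)`_k != 0.

Definition supp w := [seq i <- iota 0 (size w) | w`_i != 0].

Lemma mem_supp w i : (i \in supp w) = (w`_i != 0).
Proof.
rewrite mem_filter mem_iota add0n /=; case: ltnP => [_|wi]; first exact: andbT.
by rewrite nth_default // eqxx.
Qed.

Lemma supp_uniq w : uniq (supp w).
Proof. by rewrite filter_uniq // iota_uniq. Qed.

Lemma join_seq_leP (r : seq nat) (t : nat -> S) u :
  (\join_(j <- r) t j <= u)%O <-> forall j, j \in r -> (t j <= u)%O.
Proof.
elim: r => [|j r IH]; first by rewrite big_nil le0x.
rewrite big_cons leUx; split=> [/andP[ju ru] k|h].
  by rewrite inE => /predU1P[->//|]; move: k; apply/IH.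
by rewrite h ?mem_head //; apply/IH => k kr; rewrite h // inE kr orbT.
Qed.

Lemma labels_supp w : labels w (\join_(i <- supp w) l i)%O.
Proof.
move=> u; split=> [/join_seq_leP h i wi|h]; first by apply: h; rewrite mem_supp.
by apply/join_seq_leP => i; rewrite mem_supp; apply: h.
Qed.

Lemma labels_inj w s t : labels w s -> labels w t -> s = t.
Proof.
move=> ws wt; apply/le_anti/andP.
by split; [apply/ws/wt|apply/wt/ws].
Qed.

Lemma labelsXn i : labels 'X^i (l i).
Proof.
move=> u; split=> [iu j|/(_ i)]; rewrite coefXn; last by rewrite eqxx; apply.
by case: (j =P i) => [->|]; rewrite ?eqxx.
Qed.

Lemma labelsD v w s t : nneg v -> nneg w ->
  labels v s -> labels w t -> labels (v + w) (s `|` t)%O.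
Proof.
move=> v0 w0 vs wt u; rewrite leUx; split=> [/andP[/vs su /wt tu] i|h].
  rewrite coefD paddr_eq0 // negb_and => /orP[]; [exact: su|exact: tu].
apply/andP; split; [apply/vs|apply/wt] => i ni; apply: h.
  by rewrite coefD paddr_eq0 // negb_and ni.
by rewrite coefD paddr_eq0 // negb_and ni orbT.
Qed.

Lemma labels_transfer g w s : refines g -> nneg w ->
  labels w s -> labels (transfer g w) s.
Proof.
move=> gl w0 ws u; split=> [/ws h k|h].
  by case/transfer_suppP=> // i /h/gl; apply.
apply/ws => i wi; apply/gl => k ki; apply: h.
by apply/transfer_suppP => //; exists i.
Qed.

(** * Absorbing replacements from distributivity *)

Hypothesis l_surj : forall s, exists i, l i = s.
Hypothesis S_distributive : distributive_semilattice S.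

Lemma distributive_seq (r : seq nat) (b : nat -> S) s :
  uniq r -> (s <= \join_(j <- r) b j)%O ->
  exists2 t : nat -> S, forall j, (t j <= b j)%O & s = (\join_(j <- r) t j)%O.
Proof.
elim: r s => [|j r IH] s /=.
  rewrite !big_nil lex0 => _ /eqP->; exists (fun=> \bot%O) => [j|].
    exact: le0x.
  by rewrite big_nil.
case/andP=> jr ur; rewrite big_cons => /S_distributive[s0 [s1 [s0b /IH[//|t tb ->] ->]]].
(* Setting the value at [j] leaves the tail unchanged, since [j] does not occur in [r]. *)
exists (fun k => if k == j then s0 else t k) => [k|]; first by case: eqP => [->|].
rewrite big_cons eqxx; congr (_ `|` _)%O.
rewrite big_seq [RHS]big_seq; apply: eq_bigr => k kr.
by case: eqP => // kj; rewrite -kj kr in jr.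
Qed.

Lemma absorbs_exists v w : exists2 g, refines g & absorbs g v w.
Proof.
pose A := supp v; pose B := supp w.
(* If some label on [A] is not below the join over [B], then [s <= t] is impossible and the identity
   replacement works vacuously. *)
have [vw|nvw] := pselect (forall i, i \in A -> (l i <= \join_(j <- B) l j)%O); last first.
  exists (fun i => [:: i]) => [i u|s t v0 w0 vs wt st].
    by split=> [iu k|]; [rewrite inE => /eqP->|apply; rewrite inE].
  case: nvw => i; rewrite mem_supp => vi.
  by rewrite (labels_inj (labels_supp w) wt); apply: (iffLR (vs t) st).
(* Distributivity splits [l i] into one share below each [l j]; surjectivity of [l] turns each share
   into the label of a basis vector. *)
have /choice[p pP] : forall i, exists p : nat -> nat, i \in A ->
    (forall j, (l (p j) <= l j)%O) /\ l i = (\join_(j <- B) l (p j))%O.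
  move=> i; have [iA|niA] := boolP (i \in A); last by exists id.
  have [t tl ti] := distributive_seq (supp_uniq w) (vw i iA).
  have /choice[p pt] := fun j => l_surj (t j).
  exists p => _; split=> [j|]; first by rewrite pt.
  by rewrite ti; apply: eq_bigr.
(* [i] in [A] splits into shares [p i j], one for each [j] in [B], and each [j] in [B]
   is enlarged by its share of every [i] in [A]. *)
pose g i := if i \in B then i :: [seq p a i | a <- A]
            else if i \in A then [seq p i j | j <- B] else [:: i].
exists g => [i u|s t v0 w0 vs wt st k].
  rewrite /g; case: ifP => [iB|_].
    split=> [iu k|]; last by apply; rewrite mem_head.
    rewrite inE => /predU1P[->//|/mapP[a aA ->]].
    exact: le_trans ((pP a aA).1 i) iu.
  case: ifP => [iA|_]; last first.
    by split=> [iu k|]; [rewrite inE => /eqP->|apply; rewrite inE].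
  rewrite (pP i iA).2; split=> [/join_seq_leP h k /mapP[j jB ->]|h]; first exact: h.
  by apply/join_seq_leP => j jB; apply/h/map_f.
(* If [i] lies in [B], it also produces [k] from [w]. Otherwise [k] is a share of [i], which some
   [j] in [B] has received too. *)
case/transfer_suppP=> // i vi ki; apply/transfer_suppP => //.
have iA : i \in A by rewrite mem_supp.
have [iB|niB] := boolP (i \in B); first by exists i; rewrite -?mem_supp.
move: ki; rewrite /g (negbTE niB) iA => /mapP[j jB ->].
by exists j; rewrite -?mem_supp // jB inE (map_f (fun a => p a j)) ?orbT.
Qed.

(* The replacement used at step [n] depends on the stage maps already built, hence the
   recursion on the maps themselves; [e n] is the pair treated at step [n]. *)
Fixpoint feedback (h : {poly rat} -> {poly rat} -> nat -> seq nat)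
    (e : nat -> {poly {poly rat}} * {poly {poly rat}}) n (x : {poly {poly rat}}) :=
  if n is m.+1 then
    transfer (h (feedback h e m (e m).1) (feedback h e m (e m).2)) (feedback h e m x)
    + x`_n
  else x`_0.

Lemma cofinal_enum (T : countType) (x0 : T) :
  exists e : nat -> T, forall x N, exists2 n, (N <= n)%N & e n = x.
Proof.
(* Each [n] is read as the code of a list whose entry at index 1 encodes the element. A code exceeds
   its entries, so the free first entry [N] makes the index as large as desired. *)
exists (fun n => odflt x0 (unpickle (nth 0%N (CodeSeq.decode n) 1))) => x N.
exists (CodeSeq.code [:: N; pickle x]); last by rewrite CodeSeq.codeK /= pickleK.
by have /andP[/ltnW] := CodeSeq.ltn_code [:: N; pickle x].
Qed.

Lemma absorbing_sequence : exists2 f : nat -> nat -> seq nat,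
  forall n, refines (f n) &
  forall x y N,
    exists2 n, (N <= n)%N & absorbs (f n) (stage f n x) (stage f n y).
Proof.
have /choice[h hP] : forall vw : {poly rat} * {poly rat}, exists g,
    refines g /\ absorbs g vw.1 vw.2.
  by move=> [v w]; have [g] := absorbs_exists v w; exists g.
have [e eP] := cofinal_enum (0 : {poly {poly rat}}, 0 : {poly {poly rat}}).
(* With this [f] the recursion defining [st] is that of [stage], so the pair scheduled at step [n]
   is treated at its actual stage [n] values. *)
pose st := feedback (fun v w => h (v, w)) e.
pose f n := h (st n (e n).1, st n (e n).2).
have stE n x : stage f n x = st n x by elim: n x => //= n IH x; rewrite IH.
exists f => [n|x y N]; first by case: (hP (st n (e n).1, st n (e n).2)).
have [n Nn en] := eP (x, y) N; exists n => // s t; rewrite !stE /f en.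
by case: (hP (st n x, st n y)) => _; apply.
Qed.

End Labels.

(** * Domination in the positive cone *)

Lemma pog_subr_ge0 (G : poGroupType) (x y : G) : x <= y -> 0 <= y - x.
Proof. by move=> /(@pog_leD2r G (- x)); rewrite subrr. Qed.

Lemma pog_leDl (G : poGroupType) (x y : G) : 0 <= y -> x <= x + y.
Proof. by move=> /(@pog_leD2r G x); rewrite add0r addrC. Qed.

Lemma pos_cone_proptoP (G : poGroupType) (a b : pos_cone G) :
  propto a b <-> exists n, (a : G) <= (b : G) *+ n.
Proof.
have valMn n : (b *+ n : pos_cone G) = (b : G) *+ n :> G.
  by elim: n => // n IH; rewrite [RHS]mulrS -IH mulrS.
split=> [[n _ [c /(congr1 (@pos_cone_val G))]]|[n ab]].
  by move=> abE; exists n; rewrite -valMn -abE; apply/pog_leDl/pos_coneP.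
(* The bound also holds for [n.+1], which supplies a positive multiple even when [n] is zero. *)
have abS : 0 <= (b : G) *+ n.+1 - (a : G).
  apply: pog_subr_ge0; apply: le_trans ab _; rewrite mulrSr.
  exact/pog_leDl/pos_coneP.
exists n.+1 => //; exists (PosCone abS); apply/val_inj => /=.
by rewrite valMn /= addrC subrK.
Qed.

(** * Identification of the maximal semilattice quotient *)

Section Quotient.
Variables (d : Order.disp_t) (S : bJoinSemilatticeType d) (l : nat -> S).
Variable f : nat -> nat -> seq nat.
Hypothesis l_surj : forall s, exists i, l i = s.
Hypothesis f_refines : forall n, refines l (f n).
Hypothesis f_absorbs : forall x y N,
  exists2 n, (N <= n)%N & absorbs l (f n) (stage f n x) (stage f n y).
Implicit Types (x y : {poly {poly rat}}) (s t : S).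

(** Refinements preserve labels of nonnegative vectors, so the label of a cone element is eventually
    constant and is read off at late stages. *)
Definition limit_labels x s := exists N, forall n, (N <= n)%N ->
  nneg (stage f n x) /\ labels l (stage f n x) s.

Lemma labels_stable n m x s : (size x <= n.+1)%N -> nneg (stage f n x) ->
  labels l (stage f n x) s -> (n <= m)%N ->
  nneg (stage f m x) /\ labels l (stage f m x) s.
Proof.
move=> xn x0 xs; elim: m => [|m IH]; first by rewrite leqn0 => /eqP<-.
rewrite leq_eqVlt => /predU1P[<-//|nm]; rewrite stageS; last exact: leq_trans nm.
have [xm0 xms] := IH nm; split; first exact: transfer_nneg.
exact: labels_transfer.
Qed.

Lemma cone_labels x : cone f x -> exists s, limit_labels x s.
Proof.
move=> [N xN]; pose n := maxn N (size x).
have [s xs] : exists s, labels l (stage f n x) s by eexists; exact: labels_supp.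
exists s, n => m; apply: labels_stable xs; first by rewrite leqW // leq_maxr.
by apply: xN; rewrite leq_maxl.
Qed.

Lemma limit_labels_onto s : exists2 x, cone f x & limit_labels x s.
Proof.
have [i <-] := l_surj s; pose x := token 0 'X^i.
have x1 : (size x <= 1)%N by exact: size_token.
have x0 : nneg (stage f 0 x) by rewrite stage_token => j; rewrite coefXn ler0n.
exists x; first exact: cone_stage x1 x0.
exists 0%N => n; apply: labels_stable => //; rewrite stage_token; exact: labelsXn.
Qed.

Lemma limit_labelsD x y s t : limit_labels x s -> limit_labels y t ->
  limit_labels (x + y) (s `|` t)%O.
Proof.
move=> [N xN] [M yM]; exists (maxn N M) => n; rewrite geq_max => /andP[Nn Mn].
have [x0 xs] := xN n Nn; have [y0 yt] := yM n Mn.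
by rewrite raddfD; split; [apply: nnegD|apply: labelsD].
Qed.

Lemma limit_labels_leP x y s t : limit_labels x s -> limit_labels y t ->
  (s <= t)%O <-> exists n, cone f (y *+ n - x).
Proof.
move=> [N xN] [M yM]; split=> [st|[m [K xyK]]].
  (* At a late step absorbing this pair, the support of [x] moves into that of [y]; the domination
     is then obtained at stage [n.+1]. *)
  have [n] := f_absorbs x y (maxn (maxn N M) (maxn (size x) (size y))).
  rewrite !geq_max => /andP[/andP[Nn Mn] /andP[xn yn]] absn.
  have [x0 xs] := xN n Nn; have [y0 yt] := yM n Mn.
  have [m xym] := nneg_dominated (transfer_nneg (f n) x0) (transfer_nneg (f n) y0)
                                (absn s t x0 y0 xs yt st).
  have size_n : (size (y *+ m - x)%R <= n.+1)%N.
    rewrite (leq_trans (size_polyD _ _)) // geq_max size_polyN.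
    by rewrite -scaler_nat (leq_trans (size_scale_leq _ _)) ?leqW.
  exists m; apply: (@cone_stage f n.+1); first exact: leqW.
  by rewrite stageS // raddfB raddfMn /= raddfB raddfMn.
pose n := maxn K (maxn N M).
have [Kn Nn Mn] : [/\ (K <= n)%N, (N <= n)%N & (M <= n)%N].
  by rewrite !leq_max !leqnn !orbT.
have [x0 xs] := xN n Nn; have [y0 yt] := yM n Mn.
(* Where [y] has coordinate zero, domination forces that of [x] to be at most zero, hence zero. So
   the support of [x] lies in that of [y]. *)
apply/xs => i xi; apply: (iffLR (yt t) (lexx t)); apply: contra xi => /eqP yi.
have := xyK n Kn i; rewrite raddfB raddfMn coefB coefMn yi mul0rn sub0r oppr_ge0 => xi.
by apply/eqP/le_anti; rewrite xi x0.
Qed.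

Definition pos_labels (a : pos_cone (limit f)) s :=
  exists2 x, pos_cone_val a = \pi_(limit f) x & limit_labels x s.

Lemma pos_labels_total a : exists s, pos_labels a s.
Proof.
case: a => a; elim/quotW: a => x a0.
have [s xs] := cone_labels (iffLR (pi_limit_ge0 f x) a0).
by exists s, x.
Qed.

Lemma pos_labels_onto s : exists a, pos_labels a s.
Proof.
have [x xc xs] := limit_labels_onto s.
by exists (PosCone (iffRL (pi_limit_ge0 f x) xc)), x.
Qed.

Lemma pos_labelsD a b s t : pos_labels a s -> pos_labels b t ->
  pos_labels (a + b) (s `|` t)%O.
Proof.
move=> [x ax xs] [y bx yt]; exists (x + y); last exact: limit_labelsD.
by rewrite limitD -ax -bx.
Qed.

Lemma pos_labels_proptoP a b s t : pos_labels a s -> pos_labels b t ->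
  propto a b <-> (s <= t)%O.
Proof.
move=> [x ax xs] [y bx yt]; apply: iff_trans (pos_cone_proptoP a b) _.
apply: iff_trans (iff_sym (limit_labels_leP xs yt)); rewrite ax bx.
by split=> -[n h]; exists n; move: h; rewrite -limitMn pi_limit_le.
Qed.

Lemma limit_nabla_isomorphic : semilattice_isomorphic S (nabla (pos_cone (limit f))).
Proof.
have /choice[e eP] := pos_labels_onto.
have /choice[r rP] := pos_labels_total.
pose phi s := \pi_(nabla (pos_cone (limit f))) (e s).
exists phi; split.
  (* The inverse takes a class to the label of a representative; mutual domination amounts to
     equality of labels. *)
  exists (fun a => r (repr a)) => [s|a].
    have : asymp (repr (phi s)) (e s) by apply/pi_nablaP; rewrite reprK.
    move=> [/(pos_labels_proptoP (rP _) (eP s)) le1].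
    move=> /(pos_labels_proptoP (eP s) (rP _)) le2.
    by apply/le_anti/andP.
  rewrite -[RHS]reprK; apply/pi_nablaP; split.
    exact/(pos_labels_proptoP (eP _) (rP _)).
  exact/(pos_labels_proptoP (rP _) (eP _)).
move=> s t; rewrite [RHS]pi_nabla_join; apply/pi_nablaP.
have est := pos_labelsD (eP s) (eP t).
by split; [apply/(pos_labels_proptoP (eP _) est)|apply/(pos_labels_proptoP est (eP _))].
Qed.

(** A positive element labelled by the top dominates every positive element, hence by directedness
    every element. *)
Lemma limit_order_unit : bounded_semilattice S -> exists u : limit f, order_unit u.
Proof.
move=> [t tP]; have [u ut] := pos_labels_onto t.
exists (pos_cone_val u); split=> [|a]; first exact: pos_coneP.
have [p [q [p0 q0 ->]]] := dimv_directed a.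
have [s ps] := pos_labels_total (PosCone p0).
have [n] := iffLR (pos_cone_proptoP _ _) (iffRL (pos_labels_proptoP ps ut) (tP s)).
move=> /= pu; exists n.+1 => //.
apply: (@le_trans _ _ p); first by rewrite -[leRHS](subrK q) pog_leDl.
by apply: le_trans pu _; rewrite mulrSr; apply/pog_leDl/pos_coneP.
Qed.

End Quotient.

(** * The representation theorem for countable semilattices *)

Local Open Scope classical_set_scope.

Theorem theorem5p2 (d : Order.disp_t) (S : bJoinSemilatticeType d)
    (S_countable : countable [set: S])
    (S_distributive : distributive_semilattice S) :
  exists E : dimVectType,
    [/\ countable [set: E],
        semilattice_isomorphic S (nabla (pos_cone E))
      & bounded_semilattice S -> exists u : E, order_unit u].
Proof.
have /countable_injP[c c_inj] := S_countable.
(* A left inverse of the injection [c], with value bottom off its range, gives the surjective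
   labelling. *)
have /choice[l lP] : forall n, exists s : S, forall t, c t = n -> t = s.
  move=> n; have [[s <-]|h] := pselect (exists s, c s = n).
    by exists s => t /c_inj; apply; rewrite inE.
  by exists \bot%O => t ct; case: h; exists t.
have l_surj s : exists i, l i = s by exists (c s); rewrite -(lP _ s).
have [f f_refines f_absorbs] := absorbing_sequence l_surj S_distributive.
exists (limit f); split; first exact: limit_countable.
  exact: limit_nabla_isomorphic.
exact: limit_order_unit.
Qed.
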